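(* Let $K=\mathbb{Q}(\sqrt{2})$ with ring of integers $O_K$, and let $$f_2(q):=\sum_{n=1}^{\infty}\frac{q^{\frac{n^2+n}{2}}(q)_{2n-2}}{(-q)_{n-1}(q)_{2n-1}}.$$ Then $$q^{-7}f_2(q^{16})=\sum_{\substack{\mathbf{a}\subset O_K\\ \mathcal{N}(\mathbf{a})\equiv 9 \pmod{16}}}q^{\mathcal{N}(\mathbf{a})},$$ where the sum runs over the nonzero ideals $\mathbf{a}$ of $O_K$ with $\mathcal{N}(\mathbf{a})\equiv 9\pmod{16}$.
   Context: Identities are between formal power series in $q$ (equivalently, for $0<|q|<1$). Notation: $(a)_n=(a;q)_n:=\prod_{j=0}^{n-1}(1-aq^j)$, so that $(q)_n=\prod_{j=1}^n(1-q^j)$ and $(-q)_n=\prod_{j=1}^n(1+q^j)$. For an ideal $\mathbf{a}$ of $O_K$, $\mathcal{N}(\mathbf{a})=|O_K/\mathbf{a}|$ is its norm. *)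

(* Defs.v *)
From HB Require Import structures.
From mathcomp Require Import all_boot all_order all_algebra all_field finmap.
From mathcomp Require Import all_classical.

Set Implicit Arguments.
Unset Strict Implicit.
Unset Printing Implicit Defensive.

Import Order.TTheory GRing.Theory Num.Theory.
Local Open Scope classical_set_scope.
Local Open Scope ring_scope.

(* The coefficients are wrapped in a record because [nat -> F] already carries
   the pointwise ring structure. *)
Record fps (F : fieldType) := Fps { fps_coef : nat -> F }.

HB.instance Definition _ (F : fieldType) := gen_eqMixin (fps F).
HB.instance Definition _ (F : fieldType) := gen_choiceMixin (fps F).

Notation "{ 'fps' F }" := (fps F) (format "{ 'fps'  F }") : type_scope.

Section FpsRing.
Variable F : fieldType.
Implicit Types f g h : {fps F}.

Lemma fpsP f g : fps_coef f =1 fps_coef g <-> f = g.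
Proof.
split=> [|-> //]; case: f g => f [g] /= efg.
by congr Fps; apply/funext.
Qed.

Definition fps_zero : {fps F} := Fps (fun=> 0).
Definition fps_opp f := Fps (fun n => - fps_coef f n).
Definition fps_add f g := Fps (fun n => fps_coef f n + fps_coef g n).
Definition fps_one : {fps F} := Fps (fun n => (n == 0%N)%:R).
Definition fps_mul f g :=
  Fps (fun n => \sum_(i < n.+1) fps_coef f i * fps_coef g (n - i)).

Fact fps_addA : associative fps_add.
Proof. by move=> f g h; apply/fpsP => n /=; rewrite addrA. Qed.
Fact fps_addC : commutative fps_add.
Proof. by move=> f g; apply/fpsP => n /=; rewrite addrC. Qed.
Fact fps_add0 : left_id fps_zero fps_add.
Proof. by move=> f; apply/fpsP => n /=; rewrite add0r. Qed.
Fact fps_addN : left_inverse fps_zero fps_opp fps_add.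
Proof. by move=> f; apply/fpsP => n /=; rewrite addNr. Qed.

HB.instance Definition _ :=
  GRing.isZmodule.Build {fps F} fps_addA fps_addC fps_add0 fps_addN.

Let tr m f : {poly F} := \poly_(i < m) fps_coef f i.

Let coef_tr m f i : (i < m)%N -> (tr m f)`_i = fps_coef f i.
Proof. by move=> lim; rewrite coef_poly lim. Qed.

Let coef_mul m f g n : (n < m)%N ->
  fps_coef (fps_mul f g) n = (tr m f * tr m g)`_n.
Proof.
move=> ltnm; rewrite coefM /=; apply: eq_bigr => i _.
have ltim : (i < m)%N by apply: leq_ltn_trans ltnm; rewrite -ltnS.
by rewrite !coef_tr // (leq_ltn_trans (leq_subr _ _)).
Qed.

Let mulE f g n : fps_coef (fps_mul f g) n =
  \sum_(i < n.+1) fps_coef f i * fps_coef g (n - i).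
Proof. by []. Qed.

Fact fps_mulC : commutative fps_mul.
Proof.
move=> f g; apply/fpsP => n.
by rewrite (coef_mul f g (ltnSn n)) (coef_mul g f (ltnSn n)) mulrC.
Qed.

Fact fps_mulA : associative fps_mul.
Proof.
move=> f g h; apply/fpsP => n.
transitivity ((tr n.+1 f * tr n.+1 g * tr n.+1 h)`_n).
  rewrite -mulrA coefM mulE; apply: eq_bigr => i _.
  by rewrite coef_tr // (@coef_mul n.+1 g h) // ltnS leq_subr.
rewrite coefM mulE; apply: eq_bigr => i _.
by rewrite (@coef_mul n.+1 f g) ?coef_tr ?ltnS ?leq_subr // -ltnS.
Qed.

Fact fps_mul1 : left_id fps_one fps_mul.
Proof.
move=> f; apply/fpsP => n /=; rewrite big_ord_recl /= mul1r subn0.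
by rewrite big1 ?addr0 // => i _; rewrite mul0r.
Qed.

Fact fps_mulDl : left_distributive fps_mul fps_add.
Proof.
move=> f g h; apply/fpsP => n /=.
by rewrite -big_split /=; apply: eq_bigr => i _; rewrite mulrDl.
Qed.

Fact fps_one_neq0 : fps_one != 0.
Proof. by apply/eqP => /fpsP/(_ 0%N)/eqP; rewrite /= oner_eq0. Qed.

HB.instance Definition _ := GRing.Zmodule_isComNzRing.Build {fps F}
  fps_mulA fps_mulC fps_mul1 fps_mulDl fps_one_neq0.

Lemma fps_coef0 n : fps_coef (0 : {fps F}) n = 0. Proof. by []. Qed.
Lemma fps_coef1 n : fps_coef (1 : {fps F}) n = (n == 0%N)%:R. Proof. by []. Qed.
Lemma fps_coefN f n : fps_coef (- f) n = - fps_coef f n. Proof. by []. Qed.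
Lemma fps_coefD f g n : fps_coef (f + g) n = fps_coef f n + fps_coef g n.
Proof. by []. Qed.
Lemma fps_coefM f g n :
  fps_coef (f * g) n = \sum_(i < n.+1) fps_coef f i * fps_coef g (n - i).
Proof. by []. Qed.

Definition fps_unit : {pred {fps F}} := [pred f | fps_coef f 0 != 0].

(* The coefficients b_0, ..., b_n of 1/f, from b_0 = 1/f_0 and
   b_m = - f_0^-1 * \sum_(i < m) b_i f_(m-i). *)
Fixpoint fps_inv_seq f n : seq F :=
  if n is m.+1 then
    let s := fps_inv_seq f m in
    rcons s (- (fps_coef f 0)^-1 *
             \sum_(i < m.+1) s`_i * fps_coef f (m.+1 - i))
  else [:: (fps_coef f 0)^-1].

(* As usual for GRing inverses, non-units are left unchanged. *)
Definition fps_inv f : {fps F} :=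
  if f \in fps_unit then Fps (fun n => (fps_inv_seq f n)`_n) else f.

Let size_inv_seq f n : size (fps_inv_seq f n) = n.+1.
Proof. by elim: n => //= n IH; rewrite size_rcons IH. Qed.

Let nth_inv_seq f i n : (i <= n)%N ->
  (fps_inv_seq f n)`_i = (fps_inv_seq f i)`_i.
Proof.
elim: n => [|n IH]; first by rewrite leqn0 => /eqP->.
rewrite leq_eqVlt => /predU1P[-> //|]; rewrite ltnS => lein.
by rewrite [LHS]/= nth_rcons size_inv_seq ltnS lein IH.
Qed.

Fact fps_mulVf : {in fps_unit, left_inverse 1 fps_inv *%R}.
Proof.
move=> f uf; rewrite /fps_inv uf; apply/fpsP => -[|n].
  by rewrite fps_coefM big_ord1 /= mulVf.
rewrite fps_coefM big_ord_recr.
have -> : fps_coef (1 : {fps F}) n.+1 = 0 by [].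
rewrite [fps_coef (Fps _) _]/= nth_rcons size_inv_seq ltnn eqxx subnn.
rewrite mulNr mulNr mulrAC mulVf // mul1r; apply/eqP; rewrite subr_eq0.
apply/eqP/eq_bigr => i _ /=; rewrite (@nth_inv_seq _ i n) // -ltnS.
exact: ltn_ord.
Qed.

Fact fps_unitPl f g : g * f = 1 -> fps_unit f.
Proof.
move=> /fpsP/(_ 0%N); rewrite fps_coefM big_ord1 /= => gf1.
by apply/eqP => f0; move/eqP: gf1; rewrite f0 mulr0 eq_sym oner_eq0.
Qed.

Fact fps_inv_out : {in [predC fps_unit], fps_inv =1 id}.
Proof. by move=> f; rewrite inE /fps_inv => /negbTE ->. Qed.

HB.instance Definition _ := GRing.ComNzRing_hasMulInverse.Build {fps F}
  fps_mulVf fps_unitPl fps_inv_out.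

Fact fps_mulf_eq0 f g : f * g = 0 -> (f == 0) || (g == 0).
Proof.
move=> fg0; apply/norP => -[f0 g0].
have ex_coef h : h != 0 -> exists n, fps_coef h n != 0.
  move=> h0; apply: contrapT => hn; move/eqP: h0; apply; apply/fpsP => n.
  by apply/eqP/negPn/negP => hn0; apply: hn; exists n.
case: (ex_minnP (ex_coef f f0)) => a fa mina.
case: (ex_minnP (ex_coef g g0)) => b gb minb.
have := congr1 (fun h => fps_coef h (a + b)%N) fg0.
have lta : (a < (a + b).+1)%N by rewrite ltnS leq_addr.
rewrite fps_coefM (bigD1 (Ordinal lta)) //= addKn big1 ?addr0; last first.
  move=> i neia.
  case: (ltngtP i a) => [ltia|ltai|eia]; last by rewrite -val_eqE /= eia eqxx in neia.
    have [->|/mina] := eqVneq (fps_coef f i) 0; first by rewrite mul0r.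
    by rewrite leqNgt ltia.
  have [->|/minb] := eqVneq (fps_coef g (a + b - i)) 0; first by rewrite mulr0.
  have leiab : (i <= a + b)%N by rewrite -ltnS.
  by rewrite leq_subRL // leq_add2r leqNgt ltai.
by move/eqP; rewrite mulf_eq0 (negbTE fa) (negbTE gb).
Qed.

HB.instance Definition _ :=
  GRing.ComUnitRing_isIntegral.Build {fps F} fps_mulf_eq0.

Definition fps_X : {fps F} := Fps (fun n => (n == 1%N)%:R).

(* Infinite sums of formal power series: a family is summable when each power
   of the variable occurs in only finitely many members, and the sum is then
   taken coefficientwise. *)
Definition fps_summable (I : choiceType) (A : set I) (f : I -> {fps F}) :=
  forall n, finite_set (A `&` [set i | fps_coef (f i) n != 0]).

Definition fps_sum (I : choiceType) (A : set I) (f : I -> {fps F}) : {fps F} :=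
  Fps (fun n => \sum_(i \in A) fps_coef (f i) n).

End FpsRing.

Notation "''q'" := (@fps_X rat) : ring_scope.

Definition qpoch (R : comNzRingType) (a q : R) (n : nat) : R :=
  \prod_(j < n) (1 - a * q ^+ j).

(* The argument is an arbitrary power series, so that f_2(q^16) is literally
   [f2 ('q ^+ 16)]. *)
Definition f2_term (q : {fps rat}) (n : nat) : {fps rat} :=
  q ^+ (n ^ 2 + n)./2 * qpoch q q (2 * n - 2)
    / (qpoch (- q) q (n - 1) * qpoch q q (2 * n - 1)).

Definition f2 (q : {fps rat}) : {fps rat} :=
  fps_sum [set n | (1 <= n)%N] (f2_term q).

Section RingOfIntegers.
Variable K : fieldExtType rat.

Definition algint : {pred K} :=
  fun x => `[< integralOver (intr : int -> K) x >].

Fact algint_subring_closed : subring_closed algint.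
Proof.
split=> [|x y /asboolP Ix /asboolP Iy|x y /asboolP Ix /asboolP Iy]; apply/asboolP.
- exact: integral1.
- exact: integral_sub.
- exact: integral_mul.
Qed.

HB.instance Definition _ :=
  GRing.isSubringClosed.Build K algint algint_subring_closed.

Record OK := MkOK { OK_val :> K; OK_int : OK_val \in algint }.

HB.instance Definition _ := [isSub for OK_val].
HB.instance Definition _ := [Choice of OK by <:].
HB.instance Definition _ := [SubChoice_isSubComNzRing of OK by <:].

End RingOfIntegers.

Definition is_ideal (R : comNzRingType) (I : set R) : Prop :=
  [/\ I 0, forall x y, I x -> I y -> I (x + y) & forall r x, I x -> I (r * x)].

(* The number of cosets x + I, with the convention 0 if there are infinitely
   many of them. *)
Definition ideal_norm (R : comNzRingType) (I : set R) : nat :=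
  #|` fset_set (range (fun x : R => [set x + y | y in I])) |.

(* Main.v *)
Require Import Defs.
From HB Require Import structures.
From mathcomp Require Import all_boot all_order all_algebra all_field finmap.
From mathcomp Require Import all_classical.
From mathcomp Require Import zify ring.

Set Implicit Arguments.
Unset Strict Implicit.
Unset Printing Implicit Defensive.

Import Order.TTheory GRing.Theory Num.Theory.
Local Open Scope classical_set_scope.
Local Open Scope ring_scope.

(** Both sides are generating functions of the same set of lattice points.

Arithmetic side.  The ring of integers is Z[sqrt 2], with x + y sqrt 2 of norm
x^2 - 2 y^2.  It is norm-Euclidean, so every nonzero ideal is principal, and
the number of cosets of (x + y sqrt 2) is |x^2 - 2 y^2|.  The unit 1 + sqrt 2
of norm -1 makes the norm of a generator positive, and multiplying by powers of
3 + 2 sqrt 2 and by -1 brings a generator of odd norm into the cone x > 0,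
2|y| < x, in a unique way ([reduced_generator], [reduced_unique]).  In this cone
the congruence x^2 - 2 y^2 = 9 mod 16 forces x = 4 n + 1 or 4 n - 1 and
y = 2 (n - 1 - 2 j) with 0 <= j < n, and then x^2 - 2 y^2 = 16 E - 7 with
E = n (n + 1) / 2 + 2 j (n - 1 - j) + (n or 0) ([hecke_ideal_bij]).

Analytic side.  It remains to see that f_2(q) is the sum of all the q^E, i.e.
  sum_(n >= 0) q^((n+1)(n+2)/2) / ((-q)_n (1 - q^(2n+1)))
    = sum_(s >= 1) q^(s(s+1)/2) (1 + q^s) B_s,
where B_s = sum_(0 <= j < s) q^(2 j (s-1-j)).  This is an instance of the Bailey
transform with kernel c(m, s) = 1 / ((q)_(m-s) (q)_(m+s)).

- The Bailey pair ([bailey_pair], [gauss_sumE]).  The sums B_s satisfy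
  B_(s+2) = 2 + q^(2s) B_s, and the kernel satisfies
  c(m,s) - q^(2s+2) c(m,s+2) = (1 - q^(2s+2)) (1 - q^(2m+1)) c(m+1,s+1).
  Summation by parts turns the alternating sum of B_s (1 - q^(2s)) c(n+1,s),
  multiplied by 1 - q^(2n+1), into the sum of (-1)^t c(n,t) over all integers t,
  which Gauss evaluated as (-1)^n / (q^2; q^2)_n.
- The conjugate pair ([conj_gammaE]).  The sum over n of
  (-1)^n q^((n+1)(n+2)/2) (q)_n c(n+1,s+1) is (-1)^s q^((s+1)(s+2)/2) divided by
  1 - q^(s+1), because consecutive values of s are linked by a telescoping sum.

Interchanging the two summations gives the identity
([partial_hecke_identity]).  On this side everything is done with finite sums
modulo q^T in a commutative ring where the 1 - q^n are invertible; the formal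
variable enters only at the end, by comparing coefficients below T. *)

(** * A Bailey pair and the finite form of the q-series identity *)

Section QSeries.
Variables (R : comUnitRingType) (q : R).
Hypothesis unit_1Bq : forall n, 1 - q ^+ n.+1 \is a GRing.unit.

Definition iqfact n : R := (qpoch q q n)^-1.

Lemma qpochS (a : R) n : qpoch a q n.+1 = qpoch a q n * (1 - a * q ^+ n).
Proof. by rewrite /qpoch big_ord_recr. Qed.

Lemma qfact_unit n : qpoch q q n \is a GRing.unit.
Proof.
by apply: rpred_prod => j _; rewrite -exprS; apply: unit_1Bq.
Qed.

Lemma iqfact0 : iqfact 0 = 1.
Proof. by rewrite /iqfact /qpoch big_ord0 invr1. Qed.

Lemma iqfactS n : iqfact n = (1 - q ^+ n.+1) * iqfact n.+1.
Proof.
rewrite /iqfact qpochS -exprS invrM ?qfact_unit ?unit_1Bq //.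
by rewrite mulrA divrr ?mul1r ?unit_1Bq.
Qed.

(** The Bailey kernel relative to a = 1.  Its support 0 <= s <= m is built in,
so that the contiguity relations below hold for all m and s. *)
Definition bkernel m s : R :=
  if (s <= m)%N then iqfact (m - s) * iqfact (m + s) else 0.

Lemma bkernel_ge s k : bkernel (s + k) s = iqfact k * iqfact (k + s + s).
Proof. by rewrite /bkernel leq_addr addKn [(s + k)%N]addnC. Qed.

Lemma bkernel_lt m s : (m < s)%N -> bkernel m s = 0.
Proof. by rewrite /bkernel ltnNge => /negbTE ->. Qed.

(** After division by the kernel on the right, with X = q^(s+1) and Y = q^(m+1):
  (1 - XY) (1 - XY/q) - X^2 (1 - Y/X) (1 - Y/(qX)) = (1 - X^2) (1 - Y^2/q).
The left-hand side is adjoint to the recurrence satisfied by [theta_sum]. *)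
Lemma bkernel_diff m s :
  bkernel m s - q ^+ s.+1 ^+ 2 * bkernel m s.+2 =
  (1 - q ^+ s.+1 ^+ 2) * (1 - q ^+ m * q ^+ m * q) * bkernel m.+1 s.+1.
Proof.
have [ltms|] := ltnP m s.
  by rewrite !bkernel_lt; first [lia | ring].
move=> /subnKC <-; move: (m - s)%N => k {m}.
rewrite -addSn !bkernel_ge.
(* For k < 2 the kernel of index s + 2 vanishes. *)
case: k => [|[|k]].
- rewrite [bkernel _ s.+2]bkernel_lt ?addn0 //.
  rewrite !addSn !addnS !add0n (iqfactS (s + s)) (iqfactS (s + s).+1).
  rewrite !exprS !exprD; ring.
- rewrite [bkernel _ s.+2]bkernel_lt; last by lia.
  rewrite !addSn !addnS !add0n (iqfactS (s + s).+1) (iqfactS (s + s).+2).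
  rewrite !exprS !addn0 !exprD; ring.
have -> : (s + k.+2 = s.+2 + k)%N by lia.
rewrite bkernel_ge (iqfactS k) (iqfactS k.+1).
rewrite !addSn !addnS (iqfactS (k + s + s).+2) (iqfactS (k + s + s).+3).
rewrite !exprS !exprD; ring.
Qed.

(** The sum of (-1)^t c(n, t) over all integers t, folded by the symmetry of the
kernel in t. *)
Definition gauss_sum n : R :=
  bkernel n 0 + 2 * \sum_(1 <= s < n.+1) (-1) ^+ s * bkernel n s.

(** With Y = q^(n+1) and X = q^t, the summand of the difference of both sides is
(-1)^t c(n+1, t) ((1 - XY) + (1 - Y/X)), which is (-1)^t (d t + d (t+1)): the
sum telescopes. *)
Lemma gauss_sum_rec n :
  gauss_sum n = - (1 - q ^+ n.+1 ^+ 2) * gauss_sum n.+1.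
Proof.
pose d s := if (s <= n.+1)%N then iqfact (n.+1 - s) * iqfact (n + s) else 0.
have kd s : bkernel n s.+1 + (1 - q ^+ n.+1 ^+ 2) * bkernel n.+1 s.+1
            = d s.+1 + d s.+2.
  rewrite /d; have [ltns|] := ltnP n s.
    by rewrite !bkernel_lt ?ifF; first [lia | ring].
  move=> /subnKC <-; move: (n - s)%N => k.
  rewrite -(addSn s k) bkernel_ge.
  case: k => [|k].
    rewrite !addn0 bkernel_lt // leqnn ltnn subnn !add0n.
    rewrite !addSn !addnS (iqfactS (s + s).+1) !exprS !exprD; ring.
  have -> : (s + k.+1 = s.+1 + k)%N by lia.
  rewrite bkernel_ge ifT ?ifT; try lia.
  have -> : (s.+1 + k.+1 - s.+1 = k.+1)%N by lia.
  have -> : (s.+1 + k.+1 - s.+2 = k)%N by lia.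
  have -> : (s.+1 + k + s.+1 = (k + s + s).+2)%N by lia.
  have -> : (s.+1 + k + s.+2 = (k + s + s).+3)%N by lia.
  have -> : (k + s.+1 + s.+1 = (k + s + s).+2)%N by lia.
  have -> : (k.+1 + s.+1 + s.+1 = (k + s + s).+3)%N by lia.
  rewrite (iqfactS k) (iqfactS (k + s + s).+2).
  rewrite !exprS !exprD !exprS; ring.
have k0 : bkernel n 0 + (1 - q ^+ n.+1 ^+ 2) * bkernel n.+1 0 = 2 * d 1%N.
  rewrite /bkernel /d /= !subn0 !addn0 subn1 addn1 /= (iqfactS n) !exprS; ring.
have tele m : \sum_(1 <= s < m.+1) (-1) ^+ s * (d s + d s.+1)
            = - d 1%N + (-1) ^+ m * d m.+1.
  elim: m => [|m IH]; first by rewrite big_geq // expr0; ring.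
  rewrite big_nat_recr //= IH exprS; ring.
have gS m : (m <= n.+1)%N ->
    gauss_sum m =
    bkernel m 0 + 2 * \sum_(1 <= s < n.+2) (-1) ^+ s * bkernel m s.
  move=> lemn; rewrite /gauss_sum (@big_cat_nat _ _ _ m.+1 1 n.+2) //=.
  rewrite [X in _ + 2 * (_ + X)]big1_seq ?addr0 // => s.
  by rewrite mem_index_iota => /and3P[_ ltms _]; rewrite bkernel_lt ?mulr0.
rewrite !gS //.
have := tele n.+1; rewrite [d n.+2]/d ltnn mulr0 addr0.
have -> : \sum_(1 <= s < n.+2) (-1) ^+ s * (d s + d s.+1) =
    \sum_(1 <= s < n.+2) (-1) ^+ s * bkernel n s
    + (1 - q ^+ n.+1 ^+ 2) * \sum_(1 <= s < n.+2) (-1) ^+ s * bkernel n.+1 s.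
  rewrite mulr_sumr -big_split /=; apply: eq_big_nat => -[|s] // _.
  by rewrite -kd; ring.
move/(canRL (addrK _)) => ->; rewrite (canRL (addrK _) k0); ring.
Qed.

Lemma gauss_sumE n :
  gauss_sum n * (qpoch q q n * qpoch (- q) q n) = (-1) ^+ n.
Proof.
elim: n => [|n IH].
  rewrite /gauss_sum big_geq // (bkernel_ge 0 0) /qpoch !big_ord0 iqfact0 expr0.
  ring.
move: IH; rewrite gauss_sum_rec !qpochS !exprS => IH.
by rewrite -[in RHS]IH; ring.
Qed.

(** The inner sum of the indefinite theta series: up to the factor q^((s-1)^2/2)
it is a sum of q^(-r^2/2) over the r of the parity of s - 1 with |r| < s. *)
Definition theta_sum s : R := \sum_(j < s) q ^+ (2 * (j * (s.-1 - j))).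

Lemma theta_sumSS s : theta_sum s.+2 = 2 + q ^+ s ^+ 2 * theta_sum s.
Proof.
rewrite /theta_sum big_ord_recl big_ord_recr /= subnn muln0 mul0n muln0 expr0.
have -> : \sum_(i < s) q ^+ (2 * (bump 0 i * (s.+1 - bump 0 i))) =
   q ^+ s ^+ 2 * \sum_(i < s) q ^+ (2 * (i * (s.-1 - i))).
  rewrite mulr_sumr; apply: eq_bigr => i _; rewrite -exprM -exprD.
  congr (_ ^+ _); rewrite /bump /= add1n subSS.
  by case: i => i /= /subnKC; move: (s - i.+1)%N => k <-; nia.
ring.
Qed.

(** Summation by parts against the recurrence of [theta_sum].  The last term is
the boundary term; it vanishes when c is a kernel of index n. *)
Lemma theta_sum_abel (c : nat -> R) n :
  \sum_(s < n.+1) (-1) ^+ s * theta_sum s.+1 * (c s - q ^+ s.+1 ^+ 2 * c s.+2) =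
  c 0%N + 2 * \sum_(1 <= s < n.+1) (-1) ^+ s * c s
  + (-1) ^+ n * (q ^+ n ^+ 2 * theta_sum n * c n.+1
                 - q ^+ n.+1 ^+ 2 * theta_sum n.+1 * c n.+2).
Proof.
elim: n => [|n IH].
  rewrite big_ord1 big_geq // /theta_sum big_ord1 big_ord0 /= mul0n muln0.
  by rewrite !expr0 !expr1; ring.
rewrite big_ord_recr IH [in RHS]big_nat_recr //= (theta_sumSS n).
by rewrite [(-1) ^+ n.+1]exprS; ring.
Qed.

Lemma bailey_pair n :
  (1 - q ^+ n * q ^+ n * q) *
    \sum_(s < n.+1) (-1) ^+ s * theta_sum s.+1 *
                     ((1 - q ^+ s.+1 ^+ 2) * bkernel n.+1 s.+1) = gauss_sum n.
Proof.
transitivity (\sum_(s < n.+1) (-1) ^+ s * theta_sum s.+1 *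
    (bkernel n s - q ^+ s.+1 ^+ 2 * bkernel n s.+2)).
  by rewrite mulr_sumr; apply: eq_bigr => s _; rewrite bkernel_diff; ring.
rewrite theta_sum_abel /gauss_sum.
rewrite [bkernel n n.+1]bkernel_lt // [bkernel n n.+2]bkernel_lt //.
ring.
Qed.

(** The Bailey pair solved for its beta side, which is the nontrivial factor of
the terms of f_2. *)
Lemma inv_qpochE n :
  (qpoch (- q) q n * (1 - q ^+ n * q ^+ n * q))^-1 =
  (-1) ^+ n * qpoch q q n *
    \sum_(s < n.+1) (-1) ^+ s * theta_sum s.+1 *
                     ((1 - q ^+ s.+1 ^+ 2) * bkernel n.+1 s.+1).
Proof.
apply: mulr1_eq; have := gauss_sumE n; rewrite -bailey_pair.
have : (-1) ^+ n * (-1) ^+ n = 1 :> R by rewrite -expr2 sqrr_sign.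
by move=> sgn2 E; rewrite -[RHS]sgn2 -[X in _ = X * _]E; ring.
Qed.

(** Congruence modulo q^T: it replaces convergence of the infinite sums. *)
Definition congq T (x y : R) := exists h, x = y + q ^+ T * h.

Lemma congq_sum T n (F G : 'I_n -> R) :
  (forall i, congq T (F i) (G i)) -> congq T (\sum_i F i) (\sum_i G i).
Proof.
move=> FG; have /fin_all_exists[h hE] := FG.
exists (\sum_i h i); rewrite mulr_sumr -big_split /=.
by apply: eq_bigr => i _; apply: hE.
Qed.

(** The weights that the Bailey transform attaches to the pair: multiplied by
the beta side they give the terms of f_2. *)
Definition conj_delta n : R := (-1) ^+ n * q ^+ 'C(n.+2, 2) * qpoch q q n.

Lemma conj_deltaS n :
  conj_delta n.+1 = - (q ^+ n.+2 * (1 - q ^+ n.+1)) * conj_delta n.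
Proof.
by rewrite /conj_delta qpochS (binS n.+2 1) bin1 exprD !exprS; ring.
Qed.

Lemma conj_delta_small T : exists h, conj_delta T = q ^+ T * h.
Proof.
exists ((-1) ^+ T * q ^+ ('C(T.+2, 2) - T) * qpoch q q T).
have leT : (T <= 'C(T.+2, 2))%N by rewrite binS bin1; lia.
by rewrite /conj_delta -{1}(subnKC leT) exprD; ring.
Qed.

Definition conj_gamma T s : R := \sum_(n < T) conj_delta n * bkernel n.+1 s.+1.

(** Without its first two terms this is Euler's sum of
(-1)^N q^(N(N-1)/2) / (q)_N, whose partial sums are
(-1)^M q^(M(M+1)/2) / (q)_M. *)
Lemma conj_gamma0 T : congq T ((1 - q) * conj_gamma T 0) q.
Proof.
have E : (1 - q) * conj_gamma T 0 =
    q - (1 - q) * ((-1) ^+ T * q ^+ 'C(T.+2, 2) * iqfact T.+1).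
  have iq1 : (1 - q) * iqfact 1 = 1 by rewrite -[RHS]iqfact0 (iqfactS 0) expr1.
  elim: T => [|T IH].
    rewrite /conj_gamma big_ord0 expr0 (_ : 'C(2, 2) = 1)%N // expr1.
    by transitivity (q - q * ((1 - q) * iqfact 1)); [rewrite iq1|]; ring.
  rewrite /conj_gamma big_ord_recr mulrDr [X in X + _]IH /=.
  have -> : bkernel T.+1 1 = iqfact T * iqfact T.+2.
    by rewrite -[T.+1]add1n bkernel_ge !addn1.
  have := divrr (qfact_unit T); rewrite -/(iqfact T) => PT.
  rewrite /conj_delta [iqfact T.+1]iqfactS (binS T.+2 1) bin1 exprD.
  rewrite [(-1) ^+ T.+1]exprS.
  ring: PT.
have [h hE] := conj_delta_small T.
exists (- (1 - q) * h * (iqfact T * iqfact T.+1)).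
rewrite E; have := divrr (qfact_unit T); rewrite -/(iqfact T) => PT.
transitivity (q - (1 - q) * (conj_delta T * iqfact T * iqfact T.+1)); last first.
  by rewrite hE; ring.
by rewrite /conj_delta -[in LHS](mulr1 ((-1) ^+ T * _)) -PT; ring.
Qed.

(** Creative telescoping: the n-th summands t n s of [conj_gamma] satisfy
  (1 - q^(s+2)) t n (s+1) + q^(s+2) (1 - q^(s+1)) t n s
    = - (1 - q^(2s+3)) (g (n+1) - g n)
with g n = conj_delta n / ((q)_(n-s-1) (q)_(n+s+2)), which is 0 for n = 0.  So
only the end term g T is left, and it is divisible by q^T. *)
Lemma conj_gammaS T s :
  congq T ((1 - q ^+ s.+2) * conj_gamma T s.+1)
          (- (q ^+ s.+2 * ((1 - q ^+ s.+1) * conj_gamma T s))).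
Proof.
(* g n = conj_delta n * k2 n *)
pose k2 n := if (s < n)%N then iqfact (n - s.+1) * iqfact (n + s.+2) else 0.
have E : (1 - q ^+ s.+2) * conj_gamma T s.+1
         + q ^+ s.+2 * ((1 - q ^+ s.+1) * conj_gamma T s)
         = - (1 - q ^+ s.+1 * q ^+ s.+1 * q) * (conj_delta T * k2 T).
  elim: T => [|n IH].
    by rewrite /conj_gamma !big_ord0 /k2 ltn0; ring.
  rewrite /conj_gamma !big_ord_recr /= -!/(conj_gamma _ _).
  rewrite !(mulrDr _ (conj_gamma n _)) (mulrDr (q ^+ s.+2)) addrACA IH {IH}.
  rewrite conj_deltaS.
  suff kE : (1 - q ^+ s.+2) * bkernel n.+1 s.+2
      + q ^+ s.+2 * (1 - q ^+ s.+1) * bkernel n.+1 s.+1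
      = (1 - q ^+ s.+1 * q ^+ s.+1 * q)
        * (q ^+ n.+2 * (1 - q ^+ n.+1) * k2 n.+1 + k2 n).
    transitivity (conj_delta n * ((1 - q ^+ s.+2) * bkernel n.+1 s.+2
      + q ^+ s.+2 * (1 - q ^+ s.+1) * bkernel n.+1 s.+1
      - (1 - q ^+ s.+1 * q ^+ s.+1 * q) * k2 n)); first by ring.
    by rewrite kE; ring.
  rewrite /k2; have [ltns|] := ltnP n s.
    by rewrite !bkernel_lt ?ifF; first [lia | ring].
  move=> /subnKC <-; move: (n - s)%N => k.
  rewrite -(addSn s k) bkernel_ge.
  case: k => [|k].
    rewrite !addn0 bkernel_lt // leqnn ltnn subnn !add0n !addSn !addnS.
    rewrite (iqfactS (s + s).+2) !exprS !exprD; ring.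
  have -> : (s.+1 + k.+1 = s.+2 + k)%N by lia.
  have -> : (s + k.+1 = s.+1 + k)%N by lia.
  rewrite bkernel_ge !ifT; try lia.
  have -> : (s.+2 + k - s.+1 = k.+1)%N by lia.
  have -> : (s.+1 + k - s.+1 = k)%N by lia.
  have -> : (s.+1 + k + s.+2 = (k + s + s).+3)%N by lia.
  have -> : (s.+2 + k + s.+2 = (k + s + s).+4)%N by lia.
  have -> : (k + s.+2 + s.+2 = (k + s + s).+4)%N by lia.
  have -> : (k.+1 + s.+1 + s.+1 = (k + s + s).+3)%N by lia.
  rewrite (iqfactS k) (iqfactS (k + s + s).+3).
  rewrite !exprS !exprD ?exprS; ring.
have [h hE] := conj_delta_small T.
exists (- (1 - q ^+ s.+1 * q ^+ s.+1 * q) * h * k2 T).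
by rewrite (canRL (addrK _) E) hE; ring.
Qed.

Lemma conj_gammaE T s :
  congq T ((1 - q ^+ s.+1) * conj_gamma T s) ((-1) ^+ s * q ^+ 'C(s.+2, 2)).
Proof.
elim: s => [|s [h hE]].
  by rewrite expr0 (_ : 'C(2, 2) = 1)%N // mul1r expr1; apply: conj_gamma0.
have [h' ->] := conj_gammaS T s; rewrite hE.
exists (h' - q ^+ s.+2 * h).
by rewrite (binS s.+2 1) bin1 exprD [(-1) ^+ s.+1]exprS; ring.
Qed.

(** The Bailey transform: insert [inv_qpochE], exchange the sums over n and s,
and evaluate the sum over n by [conj_gammaE].  The factor 1 - q^(2s+2) of the
pair cancels the denominator 1 - q^(s+1) and leaves 1 + q^(s+1). *)
Lemma partial_hecke_identity T :
  congq T
    (\sum_(n < T) q ^+ 'C(n.+2, 2)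
                  / (qpoch (- q) q n * (1 - q ^+ n * q ^+ n * q)))
    (\sum_(s < T) q ^+ 'C(s.+2, 2) * (1 + q ^+ s.+1) * theta_sum s.+1).
Proof.
have -> : \sum_(n < T) q ^+ 'C(n.+2, 2)
                  / (qpoch (- q) q n * (1 - q ^+ n * q ^+ n * q)) =
  \sum_(s < T) (-1) ^+ s * theta_sum s.+1 *
     ((1 + q ^+ s.+1) * ((1 - q ^+ s.+1) * conj_gamma T s)).
  transitivity (\sum_(n < T) \sum_(s < T) (-1) ^+ s * theta_sum s.+1 *
      ((1 - q ^+ s.+1 ^+ 2) * (conj_delta n * bkernel n.+1 s.+1))).
    apply: eq_bigr => n _; rewrite inv_qpochE.
    rewrite (big_ord_widen T (fun s => (-1) ^+ s * theta_sum s.+1 *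
                     ((1 - q ^+ s.+1 ^+ 2) * bkernel n.+1 s.+1))) //.
    rewrite !mulrA mulr_sumr big_mkcond /=; apply: eq_bigr => s _.
    case: ifP => sn; first by rewrite /conj_delta; ring.
    by rewrite bkernel_lt; first [lia | ring].
  rewrite exchange_big; apply: eq_bigr => s _ /=.
  rewrite /conj_gamma !mulr_sumr; apply: eq_bigr => n _; ring.
apply: congq_sum => s; have [h ->] := conj_gammaE T s.
exists ((-1) ^+ s * theta_sum s.+1 * (1 + q ^+ s.+1) * h).
have sgn2 : (-1) ^+ s * (-1) ^+ s = 1 :> R by rewrite -expr2 sqrr_sign.
ring: sgn2.
Qed.

End QSeries.

(** * Coefficients of formal power series *)

Section FpsCoefficients.
Variable F : fieldType.
Implicit Types f g : {fps F}.

Lemma fps_coef_sum (I : Type) (r : seq I) (P : pred I) (f : I -> {fps F}) n :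
  fps_coef (\sum_(i <- r | P i) f i) n = \sum_(i <- r | P i) fps_coef (f i) n.
Proof. exact: (big_morph (fun h => fps_coef h n) (fun g h => erefl) erefl). Qed.

Lemma fps_coefXM f n :
  fps_coef (@fps_X F * f) n = if n is m.+1 then fps_coef f m else 0.
Proof.
case: n => [|n]; first by rewrite fps_coefM big_ord1 /= mul0r.
rewrite fps_coefM !big_ord_recl /= mul0r add0r mul1r subSS subn0 big1 ?addr0 //.
by move=> i _; rewrite mul0r.
Qed.

Lemma fps_coefXnM m f n :
  fps_coef (@fps_X F ^+ m * f) n = if (n < m)%N then 0 else fps_coef f (n - m).
Proof.
elim: m n => [|m IH] n; first by rewrite expr0 mul1r subn0.
by rewrite exprS -mulrA fps_coefXM; case: n => [|n] //; rewrite IH ltnS subSS.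
Qed.

Lemma fps_coefXn m n : fps_coef (@fps_X F ^+ m) n = (n == m)%:R.
Proof.
rewrite -[_ ^+ m]mulr1 fps_coefXnM fps_coef1 subn_eq0.
by case: ltngtP.
Qed.

End FpsCoefficients.

(** * The expansion of f_2 as an indefinite theta series *)

Section F2Expansion.

Local Notation Q := ('q ^+ 16).

Lemma unit_1BQ n : 1 - Q ^+ n.+1 \is a GRing.unit.
Proof.
suff : fps_coef (1 - Q ^+ n.+1) 0 != 0 by [].
rewrite -exprM fps_coefD fps_coefN fps_coefXn fps_coef1.
by rewrite eqxx mulnS subr0 oner_eq0.
Qed.

(** The quotient (q)_(2n) / (q)_(2n+1) collapses to 1 / (1 - q^(2n+1)). *)
Lemma f2_termE n :
  f2_term Q n.+1 =
  Q ^+ 'C(n.+2, 2) / (qpoch (- Q) Q n * (1 - Q ^+ n * Q ^+ n * Q)).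
Proof.
rewrite /f2_term.
have -> : ((n.+1 ^ 2 + n.+1)./2 = 'C(n.+2, 2))%N.
  by rewrite bin2 (_ : n.+1 ^ 2 + n.+1 = n.+2 * n.+1)%N; last nia.
have -> : (2 * n.+1 - 2 = n + n)%N by lia.
have -> : (2 * n.+1 - 1 = (n + n).+1)%N by lia.
rewrite subn1 /= qpochS exprD [Q * _]mulrC.
have uP := qfact_unit unit_1BQ (n + n).
have uL : 1 - Q ^+ n * Q ^+ n * Q \is a GRing.unit.
  by rewrite -exprD -exprSr unit_1BQ.
have uM : qpoch (- Q) Q n \is a GRing.unit.
  have := gauss_sumE unit_1BQ n => /(congr1 (fun x => x \is a GRing.unit)).
  by rewrite unitrX ?unitrN1 // !unitrM => /and3P[].
set P := qpoch Q Q _ in uP *; set M := qpoch (- Q) Q n in uM *.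
set L := 1 - _ in uL *; set C := Q ^+ _.
have uML : M * L \is a GRing.unit by rewrite unitrM uM.
rewrite (_ : M * (P * L) = M * L * P); last by ring.
by rewrite [(_ * P)^-1]invrM // mulrA mulrK.
Qed.

(** A triple (n, j, e) indexes a term of the double sum; e selects the summand
q^n of the factor 1 + q^n. *)
Definition hecke_index : set (nat * nat * bool) := [set i | (i.1.2 < i.1.1)%N].

Definition hecke_exp (i : nat * nat * bool) : nat :=
  'C(i.1.1.+1, 2) + 2 * (i.1.2 * (i.1.1.-1 - i.1.2))
  + (if i.2 then i.1.1 else 0).

(** This bound makes the family summable: an exponent at most k leaves finitely
many triples. *)
Lemma hecke_exp_ge i : (i.1.1 <= hecke_exp i)%N.
Proof. by rewrite /hecke_exp binS bin1 -!addnA addnCA leq_addr. Qed.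

Lemma coefQ m n : fps_coef (Q ^+ m) n = (n == 16 * m)%N%:R.
Proof. by rewrite -exprM fps_coefXn. Qed.

Lemma coefQM m f n : (n < m)%N -> fps_coef (Q ^+ m * f) n = 0.
Proof. by move=> ltnm; rewrite -exprM fps_coefXnM ifT //; lia. Qed.

Lemma f2_term_coef0 n k : (k < n)%N -> fps_coef (f2_term Q n.+1) k = 0.
Proof.
move=> ltkn; rewrite f2_termE coefQM // binS bin1; lia.
Qed.

Lemma f2_summable : fps_summable [set n | (1 <= n)%N] (f2_term Q).
Proof.
move=> k; apply: sub_finite_set (finite_II k.+2) => -[|n] //= [_].
by rewrite !ltnS; apply: contra_neqT; rewrite -ltnNge => /f2_term_coef0.
Qed.

Lemma hecke_sum_coef (T : nat) k : (k < T)%N ->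
  \sum_(i \in hecke_index) fps_coef (Q ^+ hecke_exp i) k =
  fps_coef (\sum_(s < T) Q ^+ 'C(s.+2, 2) * (1 + Q ^+ s.+1) * theta_sum Q s.+1) k.
Proof.
move=> ltkT.
pose r := [seq (p, e) | p <- [seq (s.+1, j) | s <- iota 0 T, j <- iota 0 s.+1],
                        e <- [:: false; true]].
have ur : uniq r.
  apply: allpairs_uniq => //; last by move=> [a b] [c d] _ _ /= [-> ->].
  apply: allpairs_uniq_dep; rewrite ?iota_uniq //.
    by move=> s _; apply: iota_uniq.
  by move=> [a b] [c d] _ _ /= [-> ->].
have memr i : (i \in r) = (i.1.2 < i.1.1 <= T)%N.
  apply/allpairsP/idP => [[[p e] [/allpairsPdep[s [j [sT js E]]] _ ->]]|].
    rewrite [p]E /=.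
    by move: sT js; rewrite !mem_iota /=; lia.
  case: i => -[[|s] j] e /andP[] // js sT.
  exists ((s.+1, j), e); split; [|by case: (e)|by []].
  apply/flatten_mapP; exists s; first by rewrite mem_iota.
  by apply/mapP; exists j; first by rewrite mem_iota.
rewrite (@fsbigE _ _ _ _ _ r) //; first last.
- move=> i iA; rewrite memr iA /= -ltnNge coefQ => Ti; rewrite (_ : _ == _ = false) //.
  by have := hecke_exp_ge i; lia.
- by move=> i /=; rewrite memr => /andP[].
have -> : \sum_(i <- r | i \in hecke_index) fps_coef (Q ^+ hecke_exp i) k
   = \sum_(i <- r) fps_coef (Q ^+ hecke_exp i) k.
  rewrite big_mkcond; apply: eq_big_seq => i; rewrite memr => /andP[ij _].
  by rewrite ifT // inE.
have iotaE n (G : nat -> rat) : \sum_(i <- iota 0 n) G i = \sum_(i < n) G i.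
  by rewrite -(big_mkord xpredT) /index_iota subn0.
rewrite /r !big_allpairs_dep iotaE fps_coef_sum; apply: eq_bigr => s _.
rewrite /theta_sum mulr_sumr fps_coef_sum iotaE; apply: eq_bigr => j _.
rewrite big_cons big_seq1.
transitivity (fps_coef (Q ^+ hecke_exp (s.+1, j : nat, false)
                        + Q ^+ hecke_exp (s.+1, j : nat, true)) k) => //.
apply: (congr1 (fun f => fps_coef f k)).
by rewrite /hecke_exp /= addn0 !exprD; ring.
Qed.

(** The coefficient of index k on either side only involves finitely many terms,
and the congruence modulo Q^(k+1) between the partial sums determines it. *)
Lemma f2_heckeE :
  f2 Q = fps_sum hecke_index (fun i => Q ^+ hecke_exp i).
Proof.
apply/fpsP => k; rewrite [RHS](@hecke_sum_coef k.+1) //.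
have [h] := partial_hecke_identity unit_1BQ k.+1.
move=> /(congr1 (fun f => fps_coef f k)); rewrite fps_coefD coefQM // addr0 => <-.
rewrite fps_coef_sum.
transitivity (\sum_(i \in [set n | (1 <= n)%N]) fps_coef (f2_term Q i) k) => //.
rewrite (@fsbigE _ _ _ _ _ (index_iota 1 k.+2)) ?iota_uniq //.
- rewrite (_ : \sum_(i <- _ | _) _ = \sum_(1 <= i < k.+2) fps_coef (f2_term Q i) k).
    by rewrite big_add1 big_mkord; apply: eq_bigr => n _; rewrite f2_termE.
  rewrite big_mkcond; apply: eq_big_seq => i; rewrite mem_index_iota => /andP[i1 _].
  by rewrite ifT // inE.
- by move=> i /=; rewrite mem_index_iota => /andP[].
- move=> [//|i] _; rewrite mem_index_iota => ki.
  by apply: f2_term_coef0; lia.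
Qed.

Lemma hecke_finite k :
  finite_set [set i | hecke_index i /\ (hecke_exp i <= k)%N].
Proof.
pose r := [seq (p, e) | p <- [seq (s, j) | s <- iota 0 k.+1, j <- iota 0 k.+1],
                        e <- [:: false; true]].
apply: (@sub_finite_set _ _ [set` r]); last exact: finite_seq.
move=> [[s j] e] [] /=; rewrite /hecke_index /= => js.
have := hecke_exp_ge (s, j, e) => /= sE Ek.
apply/allpairsP; exists ((s, j), e); split => //; last by case: (e).
by apply/allpairsP; exists (s, j); rewrite !mem_iota; split => //=; lia.
Qed.

End F2Expansion.

(** * The ring of integers of Q(sqrt 2) *)

Lemma even_sqr (a m : int) : a ^+ 2 = 2 * m -> exists b, a = 2 * b.
Proof.
move=> aE; exists (a %/ 2)%Z; have := divz_eq a 2.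
have r0 : 0 <= (a %% 2)%Z by apply: modz_ge0.
have r2 : (a %% 2)%Z < 2 by apply: ltz_pmod.
by move: (a %/ 2)%Z (a %% 2)%Z r0 r2; nia.
Qed.

(** The 2-adic valuations of the two sides have different parities unless b =
0. *)
Lemma sqr_eq_2sqr (a b : int) : a ^+ 2 = 2 * b ^+ 2 -> b = 0.
Proof.
move=> E; apply: contrapT => /eqP b0.
have {}E : (`|a| ^ 2 = 2 * `|b| ^ 2)%N by rewrite -!abszX E abszM.
have bgt0 : (0 < `|b|)%N by rewrite absz_gt0.
have := congr1 (fun n => odd (logn 2 n)) E.
by rewrite lognM ?expn_gt0 ?bgt0 // !lognX /= oddD !oddM.
Qed.

Lemma rat_sqr_neq2 (r : rat) : r ^+ 2 != 2.
Proof.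
apply/eqP => r2.
have d0 : (denq r)%:~R != 0 :> rat by rewrite intr_eq0 denq_neq0.
have nE : (numq r)%:~R = r * (denq r)%:~R :> rat.
  by rewrite -{2}(divq_num_den r) divfK.
have : numq r ^+ 2 = 2 * denq r ^+ 2.
  apply: (@intr_inj rat); rewrite rmorphXn [RHS]rmorphM [X in _ * X]rmorphXn /=.
  by rewrite nE exprMn r2.
by move/sqr_eq_2sqr/eqP; rewrite (negbTE (denq_neq0 r)).
Qed.

(** Z is integrally closed. *)
Lemma monic_int_root_rat (p : {poly int}) (r : rat) :
  p \is monic -> root (map_poly intr p) r -> exists n : int, r = n%:~R.
Proof.
move=> pm pr; apply/intrP.
have : ratr r \in (Num.int : {pred algC}).
  apply: Cint_rat_Aint; first exact: Crat_rat.
  apply: (@root_monic_Aint (map_poly intr p)).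
  - rewrite (_ : map_poly _ p = map_poly ratr (map_poly intr p)).
      by rewrite fmorph_root.
    by rewrite -map_poly_comp; apply: eq_map_poly => b /=; rewrite ratr_int.
  - by apply: monic_map.
  - by apply/polyOverP => i; rewrite coef_map /= intr_int.
case/intrP => n; rewrite -(ratr_int _ n) => /fmorph_inj ->; exact: intr_int.
Qed.

Section QuadraticIntegers.
Variables (K : fieldExtType rat) (sqrt2 : K).
Hypotheses (sqrt2K : sqrt2 ^+ 2 = 2) (genK : <<1%VS; sqrt2>>%VS = {:K}%VS).

Local Notation "r %:K" := (in_alg K r) (at level 2, format "r %:K").

Lemma intK (n : int) : n%:~R = (n%:~R)%:K.
Proof. by rewrite rmorph_int. Qed.

Lemma rat_coordP (x : K) : exists r s : rat, x = r%:K + s%:K * sqrt2.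
Proof.
have /Fadjoin1_polyP[p0 ->] : x \in <<1; sqrt2>>%VS by rewrite genK memvf.
suff coordp (f : {rmorphism rat -> K}) (p : {poly rat}) :
    exists r s : rat, (map_poly f p).[sqrt2] = f r + f s * sqrt2.
  exact: (coordp (in_alg K) p0).
elim/poly_ind: p => [|p c [r [s IH]]].
  by exists 0, 0; rewrite map_poly0 horner0 !rmorph0; ring.
exists (2 * s + c), r.
rewrite rmorphD rmorphM /= map_polyX map_polyC /= hornerMXaddC IH.
by rewrite rmorphD rmorphM rmorph_nat -sqrt2K; ring.
Qed.

Lemma rat_coord_eq0 (r s : rat) : r%:K + s%:K * sqrt2 = 0 -> r = 0 /\ s = 0.
Proof.
move=> E; have s0 : s = 0.
  apply: contrapT => /eqP s0; have sK0 : s%:K != 0 by rewrite fmorph_eq0.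
  have := rat_sqr_neq2 (- (r / s)); apply/negP/negPn/eqP.
  apply: (fmorph_inj (in_alg K)); rewrite rmorphXn rmorphN fmorph_div rmorph_nat.
  rewrite -sqrt2K; congr (_ ^+ 2).
  by rewrite -mulNr (addr0_eq E) mulrC mulKf.
split=> //; apply: (fmorph_inj (in_alg K)).
by move: E; rewrite s0 !rmorph0 mul0r addr0.
Qed.

(** Conjugate numbers r + s sqrt 2 and r - s sqrt 2 are roots of the same
rational polynomials, because evaluation at both is computed by the same u and
v. *)
Lemma conj_root (p : {poly rat}) (r s : rat) :
  root (map_poly (in_alg K) p) (r%:K + s%:K * sqrt2) ->
  root (map_poly (in_alg K) p) (r%:K - s%:K * sqrt2).
Proof.
suff evalp (f : {rmorphism rat -> K}) : exists u v : rat,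
    (map_poly f p).[f r + f s * sqrt2] = f u + f v * sqrt2 /\
    (map_poly f p).[f r - f s * sqrt2] = f u - f v * sqrt2.
  have [u [v [E1 E2]]] := evalp (in_alg K).
  by rewrite /root E1 E2 => /eqP/rat_coord_eq0[-> ->]; rewrite !rmorph0 mul0r subr0.
elim/poly_ind: p => [|p c [u [v [IH1 IH2]]]].
  by exists 0, 0; rewrite map_poly0 !horner0 !rmorph0; split; ring.
exists (u * r + 2 * (v * s) + c), (u * s + v * r).
rewrite rmorphD rmorphM /= map_polyX map_polyC /= !hornerMXaddC IH1 IH2.
rewrite !rmorphD !rmorphM rmorph_nat.
by split; rewrite -sqrt2K; ring.
Qed.

Lemma rat_algint (r : rat) : r%:K \in @algint K -> exists n : int, r = n%:~R.
Proof.
move=> /asboolP[p pm pr]; apply: (monic_int_root_rat pm).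
rewrite -(fmorph_root (in_alg K)) -map_poly_comp.
by rewrite (eq_map_poly (g := intr)) // => b /=; rewrite intK.
Qed.

Lemma qint_algint (a b : int) : a%:~R + b%:~R * sqrt2 \in @algint K.
Proof.
apply: rpredD; first exact: rpred_int.
apply: rpredM; first exact: rpred_int.
apply/asboolP; exists ('X^2 - 2%:P).
  rewrite monicE lead_coefDl ?lead_coefXn //.
  by rewrite size_polyXn size_polyN size_polyC.
rewrite /root rmorphB /= map_polyXn map_polyC /= hornerD hornerN hornerXn hornerC.
by rewrite sqrt2K subrr.
Qed.

(** If x = r + s sqrt 2 is integral, so are its trace 2 r and its norm
r^2 - 2 s^2, which are rational, hence integers A and N.  Then (4 s)^2 =
2 (A^2 - 4 N) makes 4 s an integer C, and parity shows successively that
C, A and C / 2 are even. *)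
Lemma algintP (x : K) :
  reflect (exists a b : int, x = a%:~R + b%:~R * sqrt2) (x \in @algint K).
Proof.
apply: (iffP idP) => [xI|[a [b ->]]]; last exact: qint_algint.
have [r [s xE]] := rat_coordP x; rewrite {}xE in xI *.
have x'I : r%:K - s%:K * sqrt2 \in @algint K.
  have /asboolP[p pm pr] := xI; apply/asboolP; exists p => //; move: pr.
  have -> : map_poly intr p = map_poly (in_alg K) (map_poly intr p).
    by rewrite -map_poly_comp; apply: eq_map_poly => b /=; rewrite intK.
  exact: conj_root.
have [A rA] : exists A : int, 2 * r = A%:~R.
  apply: rat_algint; rewrite rmorphM rmorph_nat.
  have -> : 2 * r%:K = (r%:K + s%:K * sqrt2) + (r%:K - s%:K * sqrt2) by ring.
  exact: rpredD.
have [N NE] : exists N : int, r ^+ 2 - 2 * s ^+ 2 = N%:~R.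
  apply: rat_algint; rewrite rmorphB rmorphXn rmorphM rmorphXn rmorph_nat -sqrt2K.
  have -> : r%:K ^+ 2 - sqrt2 ^+ 2 * s%:K ^+ 2 =
            (r%:K + s%:K * sqrt2) * (r%:K - s%:K * sqrt2) by ring.
  exact: rpredM.
have intsqr (t : rat) (M : int) : t ^+ 2 = M%:~R -> exists n : int, t = n%:~R.
  move=> tM; apply: (@monic_int_root_rat ('X^2 - M%:P)).
    rewrite monicE lead_coefDl ?lead_coefXn //.
    by rewrite size_polyXn size_polyN size_polyC; case: (_ != _).
  rewrite /root rmorphB /= map_polyXn map_polyC /= hornerD hornerN hornerXn hornerC.
  by rewrite tM subrr.
have [C CE] : exists C : int, 4 * s = C%:~R.
  apply: (intsqr _ (2 * (A ^+ 2 - 4 * N))).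
  by rewrite intrM intrB intrM rmorphXn /= -rA -NE; ring.
have CAN : C ^+ 2 = 2 * (A ^+ 2 - 4 * N).
  apply: (@intr_inj rat).
  by rewrite rmorphXn [RHS]intrM intrB intrM rmorphXn /= -rA -NE -CE; ring.
have [c cE] := even_sqr CAN.
have [a aE] : exists a, A = 2 * a.
  by apply: (@even_sqr _ (c ^+ 2 + 2 * N)); move: CAN; rewrite cE; lia.
have [b bE] : exists b, c = 2 * b.
  by apply: (@even_sqr _ (a ^+ 2 - N)); move: CAN; rewrite cE aE; lia.
exists a, b; rewrite !intK; congr (_%:K + _%:K * _).
  by move: rA; rewrite aE intrM => /mulfI ->.
by move: CE; rewrite cE bE mulrA intrM => /mulfI ->.
Qed.

Definition qint a b : OK K := MkOK (qint_algint a b).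

Lemma qintP (x : OK K) : exists a b, x = qint a b.
Proof.
by have /algintP[a [b xE]] := OK_int x; exists a, b; apply: val_inj.
Qed.

Lemma qint_inj a b c d : qint a b = qint c d -> a = c /\ b = d.
Proof.
move=> /(congr1 (@OK_val K)) /= E.
have [] := @rat_coord_eq0 ((a - c)%:~R) ((b - d)%:~R).
  rewrite -!intK !intrB mulrBl addrACA -opprD E subrr //.
by move=> /eqP; rewrite intr_eq0 subr_eq0 => /eqP -> /eqP;
   rewrite intr_eq0 subr_eq0 => /eqP ->.
Qed.

Lemma qintM a b c d :
  qint a b * qint c d = qint (a * c + 2 * (b * d)) (a * d + b * c).
Proof.
apply: val_inj => /=; rewrite !(intrD, intrM); ring: sqrt2K.
Qed.

Lemma qintB a b c d : qint a b - qint c d = qint (a - c) (b - d).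
Proof. by apply: val_inj => /=; rewrite !intrB; ring. Qed.

Lemma qintD a b c d : qint a b + qint c d = qint (a + c) (b + d).
Proof. by apply: val_inj => /=; rewrite !intrD; ring. Qed.

Lemma qint0 : 0 = qint 0 0.
Proof. by apply: val_inj => /=; rewrite mul0r addr0. Qed.

Lemma qint1 : 1 = qint 1 0.
Proof. by apply: val_inj => /=; rewrite mul0r addr0. Qed.

Definition qnorm (a b : int) : int := a ^+ 2 - 2 * b ^+ 2.

Lemma qnormM a b c d :
  qnorm (a * c + 2 * (b * d)) (a * d + b * c) = qnorm a b * qnorm c d.
Proof. by rewrite /qnorm; ring. Qed.

Lemma qnorm_eq0 a b : qnorm a b = 0 -> a = 0 /\ b = 0.
Proof.
move=> /eqP; rewrite subr_eq0 => /eqP E; have b0 := sqr_eq_2sqr E.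
split=> //; apply/eqP; move/eqP: E.
by rewrite b0 expr0n mulr0 sqrf_eq0.
Qed.

(** * Ideals of Z[sqrt 2] and their norms *)

Definition principal (x : OK K) : set (OK K) := [set z * x | z in [set: OK K]].

Lemma principal_ideal x : is_ideal (principal x).
Proof.
split; first by exists 0; rewrite ?mul0r.
- by move=> _ _ [y _ <-] [z _ <-]; exists (y + z); rewrite ?mulrDl.
- by move=> r _ [y _ <-]; exists (r * y); rewrite ?mulrA.
Qed.

Lemma principal_unit u w x : u * w = 1 -> principal (u * x) = principal x.
Proof.
move=> uw; apply/seteqP; split => _ [z _ <-].
  by exists (z * u); rewrite // mulrA.
by exists (z * w) => //; rewrite -[RHS]mul1r -uw; ring.
Qed.

Lemma nearest_divz (p N : int) : N != 0 ->
  exists u r : int, p = u * N + r /\ 4 * r ^+ 2 <= N ^+ 2.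
Proof.
move=> N0; pose r0 := (p %% N)%Z.
have r0_ge0 : 0 <= r0 := modz_ge0 p N0.
have r0_lt : r0 < `|N| := ltz_mod p N0.
have pE : p = (p %/ N)%Z * N + r0 := divz_eq p N.
have [le|gt] := leP (2 * r0) `|N|.
  exists (p %/ N)%Z, r0; split => //.
  by rewrite -(real_normK (num_real N)); nia.
exists ((p %/ N)%Z + Num.sg N), (r0 - `|N|); split.
  by rewrite {1}pE mulrDl -normrEsg; ring.
by rewrite -(real_normK (num_real N)); nia.
Qed.

(** Euclid's argument.  Let alpha be a nonzero element of the ideal whose norm N
is least in absolute value.  For beta in the ideal, rounding the coordinates of
beta * conj(alpha) / N gives a quotient whose remainder rho satisfies
norm(rho) N = r^2 - 2 s^2 with |r|, |s| <= |N| / 2.  Hence the norm of rho is at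
most |N| / 2 in absolute value, and rho = 0 by minimality. *)
Lemma ideal_principal (I : set (OK K)) : is_ideal I -> I != [set 0] ->
  exists a b, qnorm a b != 0 /\ I = principal (qint a b).
Proof.
move=> [I0 ID IM] /eqP nzI.
pose P n := `[< exists a b, [/\ I (qint a b), qnorm a b != 0 & `|qnorm a b|%N = n] >].
have exP : exists n, P n.
  apply: contrapT => noP; apply: nzI; apply/seteqP; split => [x Ix|_ -> //].
  have [a [b xE]] := qintP x; rewrite xE in Ix *.
  have [/qnorm_eq0[-> ->]|n0] := eqVneq (qnorm a b) 0; first by rewrite -qint0.
  by case: noP; exists `|qnorm a b|%N; apply/asboolP; exists a, b.
case: (ex_minnP exP) => n /asboolP[a [b [Iab n0 nE]]] minn.
exists a, b; split=> //; apply/seteqP; split => [y Iy|_ [z _ <-]]; last exact: IM.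
have [c [d yE]] := qintP y; rewrite yE in Iy *.
(* beta * conj(alpha) = (c a - 2 d b) + (d a - c b) sqrt 2 *)
have [u [r [uE r2]]] := nearest_divz (c * a - 2 * (d * b)) n0.
have [v [s [vE s2]]] := nearest_divz (d * a - c * b) n0.
have Irho : I (qint c d - qint u v * qint a b).
  by rewrite -mulNr; apply: ID => //; apply: IM.
move: Irho; rewrite qintM qintB; set c' := c - _; set d' := d - _ => Irho.
have E : qnorm c' d' * qnorm a b = r ^+ 2 - 2 * s ^+ 2.
  have rE : r = c' * a - 2 * (d' * b).
    by rewrite -[LHS](addKr (u * qnorm a b)) -uE /c' /d' /qnorm; ring.
  have sE : s = d' * a - c' * b.
    by rewrite -[LHS](addKr (v * qnorm a b)) -vE /c' /d' /qnorm; ring.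
  by rewrite rE sE /qnorm; ring.
have [/qnorm_eq0[c0 d0]|n'0] := eqVneq (qnorm c' d') 0.
  exists (qint u v) => //; rewrite qintM.
  by congr (qint _ _); apply/esym/subr0_eq.
have : P `|qnorm c' d'|%N by apply/asboolP; exists c', d'.
move=> /minn; rewrite -nE => le; exfalso.
move: le E n0 n'0 r2 s2; move: (qnorm c' d') (qnorm a b) => M N.
move=> le E n0 n'0 r2 s2.
have {}le : `|N| <= `|M| by lia.
have nM2 : 2 * `|M * N| <= N ^+ 2.
  by rewrite E; move: r2 s2; have := sqr_ge0 r; have := sqr_ge0 s; lia.
have : N ^+ 2 <= `|M * N|.
  by rewrite -(real_normK (num_real N)) expr2 normrM ler_wpM2r.
have : 0 < N ^+ 2 by rewrite exprn_even_gt0.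
lia.
Qed.

Lemma coset_eq (I : set (OK K)) (x y : OK K) : is_ideal I ->
  [set x + z | z in I] = [set y + z | z in I] <-> I (x - y).
Proof.
move=> [I0 ID IM]; split => [E|Ixy].
  have : [set y + z | z in I] x by rewrite -E; exists 0; rewrite ?addr0.
  by case=> z Iz <-; rewrite addrAC subrr add0r.
have Iyx : I (y - x) by rewrite -opprB -mulN1r; apply: IM.
apply/seteqP; split=> _ [z Iz <-].
  by exists (x - y + z); [apply: ID | rewrite addrA subrKC].
by exists (y - x + z); [apply: ID | rewrite addrA subrKC].
Qed.

(** An ideal which projects onto g Z under the second coordinate and meets the
first axis in h Z has the box [0, h) x [0, g) as a set of representatives. *)
Lemma lattice_index (I : set (OK K)) (g h : nat) (e : int) : is_ideal I ->
  (0 < g)%N -> (0 < h)%N -> I (qint e g%:Z) -> I (qint h%:Z 0) ->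
  (forall m k, I (qint m k) -> (g%:Z %| k)%Z) ->
  (forall m, I (qint m 0) -> (h%:Z %| m)%Z) ->
  ideal_norm I = (g * h)%N.
Proof.
move=> idI g0 h0 Ig Ih dvd_g dvd_h; have [I0 ID IM] := idI.
apply: card_fset_set; apply: card_esym.
pose rep i := [set qint (i %/ g)%N%:Z (i %% g)%N%:Z + z | z in I].
have /(@pPbij _ _ _)[f _] : set_bij `I_(g * h)
    (range (fun x => [set x + y | y in I])) rep; last by apply: pcard_eq f.
split.
- by move=> i _; exists (qint (i %/ g)%N%:Z (i %% g)%N%:Z).
- move=> i j; rewrite !inE /= => ltig ltjg /(coset_eq _ _ idI).
  rewrite qintB => Iij.
  have Em : (i %% g = j %% g)%N.
    have := dvd_g _ _ Iij; rewrite -eqz_mod_dvd !modz_nat !modn_mod.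
    by move/eqP => [].
  have Ed : (i %/ g = j %/ g)%N.
    move: Iij; rewrite Em subrr => /dvd_h; rewrite -eqz_mod_dvd !modz_nat.
    by rewrite !modn_small ?ltn_divLR 1?mulnC // => /eqP[].
  by rewrite (divn_eq i g) (divn_eq j g) Em Ed.
- move=> _ [x _ <-]; have [m [k ->]] := qintP x.
  pose t := (k %/ g)%Z; pose k0 := `|(k %% g)%Z|%N.
  pose m1 := m - t * e; pose m0 := `|(m1 %% h)%Z|%N.
  have k0E : (k %% g)%Z = k0%:Z by rewrite gez0_abs // modz_ge0 //; lia.
  have m0E : (m1 %% h)%Z = m0%:Z by rewrite gez0_abs // modz_ge0 //; lia.
  have k0lt : (k0 < g)%N by rewrite -ltz_nat -k0E ltz_pmod.
  have m0lt : (m0 < h)%N by rewrite -ltz_nat -m0E ltz_pmod.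
  exists (m0 * g + k0)%N => /=; first by nia.
  rewrite /rep divnMDl // modnMDl divn_small // modn_small // addn0.
  apply/coset_eq => //; rewrite qintB.
  have kE := divz_eq k g; have mE := divz_eq m1 h.
  have -> : qint (m0%:Z - m) (k0%:Z - k) =
     qint (- t) 0 * qint e g%:Z + qint (- (m1 %/ h)%Z) 0 * qint h%:Z 0.
    rewrite !qintM qintD; congr qint; last by rewrite -k0E {2}kE; ring.
    by rewrite -m0E; move: mE; rewrite /m1; lia.
  by apply: ID; apply: IM.
Qed.

(** Let g = gcd(a, b), a = g a', b = g b'.  The second coordinates of the
multiples of a + b sqrt 2 generate g Z.  A multiple with second coordinate 0
comes from a factor t (a' - b' sqrt 2), as a' and b' are coprime, so it is t
times g (a'^2 - 2 b'^2); the product of the two indices is |a^2 - 2 b^2|. *)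
Lemma ideal_norm_principal a b : qnorm a b != 0 ->
  ideal_norm (principal (qint a b)) = `|qnorm a b|%N.
Proof.
move=> n0; have idI := principal_ideal (qint a b).
have [u [v uv]] := Bezoutz a b.
have g0 : gcdz a b != 0.
  rewrite gcdz_eq0; apply: contra n0 => /andP[/eqP-> /eqP->].
  by rewrite /qnorm expr0n mulr0 subrr.
have /dvdzP[a' aE] := dvdz_gcdl a b; have /dvdzP[b' bE] := dvdz_gcdr a b.
have uv' : u * a' + v * b' = 1.
  by apply: (mulIf g0); rewrite mulrDl -!mulrA -aE -bE uv mul1r.
set g := gcdz a b in uv g0 aE bE *.
have gE : g = (`|g|%N)%:Z by [].
have nE : qnorm a b = g * (g * qnorm a' b') by rewrite /qnorm aE bE; ring.
rewrite nE abszM; apply: (@lattice_index _ _ _ (a * v + 2 * (b * u))) => //.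
- by rewrite absz_gt0.
- by rewrite absz_gt0; move: n0; rewrite nE mulf_eq0 => /norP[].
- exists (qint v u) => //; rewrite qintM -gE -uv; congr qint; ring.
- suff I0 : principal (qint a b) (qint (g * qnorm a' b') 0).
    have [p|n] := leP 0 (g * qnorm a' b'); first by rewrite gez0_abs.
    case: idI => _ _ IM; have := IM (qint (-1) 0) _ I0; rewrite qintM.
    by congr (principal _ (qint _ _)); lia.
  by exists (qint a' (- b')) => //; rewrite qintM aE bE /qnorm; congr qint; ring.
- move=> m k [z _]; have [c [d ->]] := qintP z; rewrite qintM => /qint_inj[_ <-].
  by rewrite dvdzE absz_nat -dvdzE aE bE !mulrA -mulrDl dvdz_mull.
- move=> m [z _]; have [c [d ->]] := qintP z; rewrite qintM => /qint_inj[<- E].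
  have E' : c * b' + d * a' = 0.
    by apply: (mulIf g0); rewrite mulrDl -!mulrA -aE -bE E mul0r.
  have cE : c = a' * (u * c - v * d).
    have -> : a' * (u * c - v * d) =
        c * (u * a' + v * b') - v * (c * b' + d * a') by ring.
    by rewrite uv' E'; ring.
  have dE : d = - b' * (u * c - v * d).
    have -> : - b' * (u * c - v * d) =
        d * (u * a' + v * b') - u * (c * b' + d * a') by ring.
    by rewrite uv' E'; ring.
  rewrite dvdzE absz_nat -dvdzE; apply/dvdzP; exists (u * c - v * d).
  by move: (u * c - v * d) cE dE => t -> ->; rewrite aE bE /qnorm; ring.
Qed.

(** * Reduced generators *)

(** A fundamental domain for the units of norm 1 acting on the numbers of odd
positive norm; no such number lies on the boundary 2|y| = x, where x is even.
*)
Definition reduced (x y : int) : Prop := 0 < x /\ 2 * `|y| < x.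

(** Take a generator of positive norm with least x > 0.  If 2|y| >= x, then
2|y| > x as x is odd, and multiplication by 3 - 2 sqrt 2 or 3 + 2 sqrt 2
replaces x by the smaller positive number 3 x - 4|y|. *)
Lemma reduced_generator (I : set (OK K)) : is_ideal I -> I != [set 0] ->
  odd (ideal_norm I) ->
  exists x y, [/\ reduced x y, I = principal (qint x y)
                & qnorm x y = (ideal_norm I)%:Z].
Proof.
move=> idI /(ideal_principal idI)[a [b [n0 IE]]].
have NE : ideal_norm I = `|qnorm a b|%N by rewrite IE ideal_norm_principal.
move: (ideal_norm I) NE => N NE oddN.
have N0 : (0 < N)%N by case: N oddN {NE}.
pose P (x : nat) := `[< exists y, [/\ (0 < x)%N,
  I = principal (qint x%:Z y) & qnorm x%:Z y = N%:Z] >].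
have exP : exists x, P x.
  have [c [d [IE' cdE]]] : exists c d, I = principal (qint c d) /\ qnorm c d = N%:Z.
    have [ge0|lt0] := leP 0 (qnorm a b).
      by exists a, b; split=> //; rewrite NE gez0_abs.
    (* multiply by 1 + sqrt 2, of norm -1 *)
    exists (a + 2 * b), (a + b); split; last first.
      by move: lt0 NE; rewrite /qnorm => lt0 ->; rewrite ltz0_abs //; ring.
    have uw : qint 1 1 * qint (-1) 1 = 1 by rewrite qintM qint1.
    by rewrite IE -(principal_unit _ uw) qintM; congr (principal (qint _ _)); ring.
  have [ge0|lt0] := leP 0 c.
    exists `|c|%N; apply/asboolP; exists d; rewrite gez0_abs //; split=> //.
    rewrite absz_gt0; apply/eqP => c0; move: cdE; rewrite c0 /qnorm; nia.
  exists `|c|%N; apply/asboolP; exists (- d); rewrite ltz0_abs //; split.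
  - by rewrite absz_gt0; lia.
  - have uw : qint (-1) 0 * qint (-1) 0 = 1 by rewrite qintM qint1.
    by rewrite IE' -(principal_unit _ uw) qintM; congr (principal (qint _ _)); ring.
  - by rewrite -cdE /qnorm; ring.
case: (ex_minnP exP) => x /asboolP[y [x0 Ixy nE]] minx.
exists x%:Z, y; split => //; split; first by rewrite ltz_nat.
rewrite ltNge; apply/negP => ley.
have oddx : odd x.
  apply: contraT => evenx; have xw : x%:Z = 2 * (x./2)%:Z by lia.
  have NE' : N%:Z = 2 * (2 * (x./2)%:Z ^+ 2 - y ^+ 2).
    by rewrite -nE /qnorm xw; ring.
  by move: NE' oddN; move: (2 * _ - y ^+ 2) => m; lia.
have {}ley : x%:Z < 2 * `|y| by lia.
pose y' := if 0 <= y then 3 * y - 2 * x%:Z else 3 * y + 2 * x%:Z.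
have bound : 0 < 3 * x%:Z - 4 * `|y| < x%:Z.
  move: nE; rewrite /qnorm -(real_normK (num_real y)) => nE; nia.
have : P `|(3 * x%:Z - 4 * `|y|)%R|%N.
  apply/asboolP; exists y'; rewrite gez0_abs; last lia.
  split; first by lia.
    rewrite Ixy.
    have [ge0|lt0] := leP 0 y.
      have uw : qint 3 (-2) * qint 3 2 = 1 by rewrite qintM qint1.
      rewrite -(principal_unit _ uw) qintM /y' ge0; congr (principal (qint _ _)); lia.
    have uw : qint 3 2 * qint 3 (-2) = 1 by rewrite qintM qint1.
    rewrite -(principal_unit _ uw) qintM /y' leNgt lt0 /=.
    congr (principal (qint _ _)); lia.
  rewrite -nE /qnorm /y'.
  by case: leP => y0; rewrite ?(ger0_norm y0) ?(ltr0_norm y0); ring.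
move=> /minx; lia.
Qed.

(** Two reduced generators differ by a unit u + v sqrt 2 of norm 1, where v N =
x' y - x y' is less than x x' in absolute value, while x^2 and x'^2 are less
than 2 N.  So |v| < 2, and u^2 = 1 + 2 v^2 leaves only u = 1 or -1 and v = 0.
*)
Lemma reduced_unique x y x' y' : reduced x y -> reduced x' y' ->
  principal (qint x y) = principal (qint x' y') -> x = x' /\ y = y'.
Proof.
have pos u v : reduced u v -> 0 < qnorm u v /\ u ^+ 2 < 2 * qnorm u v.
  move=> [u0 uv]; rewrite /qnorm -(real_normK (num_real v)).
  have := normr_ge0 v; move: `|v| uv => w uv w0; split.
    by nia.
  by nia.
move=> rxy rxy' E; have [N0 xN] := pos _ _ rxy; have [N'0 xN'] := pos _ _ rxy'.
have NE : qnorm x y = qnorm x' y'.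
  have := congr1 (@ideal_norm (OK K)) E.
  rewrite !ideal_norm_principal ?gt_eqF //; lia.
have : principal (qint x' y') (qint x y).
  by rewrite -E; exists 1; rewrite ?mul1r.
case=> z _; have [u [v ->]] := qintP z; rewrite qintM => /qint_inj[xE yE].
have uv1 : qnorm u v = 1.
  by apply: (mulIf (lt0r_neq0 N'0)); rewrite mul1r -qnormM xE yE NE.
have vN : v * qnorm x' y' = x' * y - x * y' by rewrite -xE -yE /qnorm; ring.
have {rxy rxy' pos E} [[x0 xy] [x'0 xy']] := (rxy, rxy').
have v1 : v ^+ 2 < 2 ^+ 2.
  have p0 : 0 < x * x' by rewrite mulr_gt0.
  have ltp : `|v * qnorm x' y'| < x * x'.
    rewrite vN; apply: (le_lt_trans (ler_normB _ _)); rewrite !normrM.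
    rewrite (gtr0_norm x0) (gtr0_norm x'0).
    have : x' * (2 * `|y|) < x' * x by rewrite ltr_pM2l.
    have : x * (2 * `|y'|) < x * x' by rewrite ltr_pM2l.
    by lia.
  have ltN : (x * x') ^+ 2 < 2 ^+ 2 * qnorm x' y' ^+ 2.
    have -> : 2 ^+ 2 * qnorm x' y' ^+ 2 = (2 * qnorm x y) * (2 * qnorm x' y').
      by rewrite NE; ring.
    by rewrite exprMn; apply: ltr_pM; rewrite ?sqr_ge0.
  rewrite -(ltr_pM2r (exprn_gt0 2 N'0)) -exprMn; apply: lt_trans ltN.
  rewrite -(real_normK (num_real (v * _))).
  by rewrite ltr_pXn2r ?nnegrE // ltW.
have u2 : u ^+ 2 = 1 + 2 * v ^+ 2 by move: uv1; rewrite /qnorm; lia.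
have sqr_lt4 w : w ^+ 2 < 2 ^+ 2 -> w = -1 \/ w = 0 \/ w = 1 :> int.
  rewrite -(real_normK (num_real w)) ltr_pXn2r ?nnegrE //; lia.
have v3 : v = 0 \/ v ^+ 2 = 1 by case: (sqr_lt4 v v1) => [|[]] ->; auto.
have sqr_neq3 : u ^+ 2 <> 3.
  move=> u3; have : u ^+ 2 < 2 ^+ 2 by rewrite u3.
  by case/sqr_lt4 => [|[]] uE; move: u3; rewrite uE.
have v0 : v = 0 by case: v3 => // vE; case: sqr_neq3; rewrite u2 vE.
have u1 : u = 1 \/ u = -1.
  have : (u == 1) || (u == -1) by rewrite -eqf_sqr u2 v0.
  by case/orP => /eqP; [left|right].
by case: u1 => u1; move: xE yE; rewrite u1 v0; lia.
Qed.

(** * Ideals of norm 9 mod 16 and the index set of the theta series *)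

Definition hecke_x (i : nat * nat * bool) : int :=
  4 * i.1.1%:Z + (if i.2 then 1 else -1).

Definition hecke_y (i : nat * nat * bool) : int :=
  2 * (i.1.1%:Z - 1 - 2 * i.1.2%:Z).

Definition hecke_ideal i := principal (qint (hecke_x i) (hecke_y i)).

Lemma hecke_reduced i : hecke_index i -> reduced (hecke_x i) (hecke_y i).
Proof.
case: i => -[s j] e; rewrite /hecke_index /hecke_x /hecke_y /= => js.
by split; case: e; lia.
Qed.

Lemma hecke_qnorm i : hecke_index i ->
  qnorm (hecke_x i) (hecke_y i) = 16 * (hecke_exp i)%:Z - 7.
Proof.
case: i => -[s j] e js; have {js} /subnKC := js : (j < s)%N.
rewrite /hecke_exp /qnorm /hecke_x /hecke_y; move: (s - j.+1)%N => k sE.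
have : 2 * ('C(s.+1, 2))%:Z = s%:Z * (s%:Z + 1).
  by have := mul_bin_diag s.+1 1; rewrite bin1; lia.
move: 'C(_, 2) => C /=; have -> : (s.-1 - j = k)%N by lia.
have {}sE : s%:Z = j%:Z + k%:Z + 1 by lia.
by case: e; rewrite ?PoszD ?PoszM ?sE => CE; nia.
Qed.

Lemma hecke_exp_gt0 i : hecke_index i -> (0 < hecke_exp i)%N.
Proof. by move=> ij; apply: leq_trans (hecke_exp_ge i); apply: leq_ltn_trans ij. Qed.

Lemma hecke_ideal_norm i : hecke_index i ->
  ideal_norm (hecke_ideal i) = (16 * hecke_exp i - 7)%N.
Proof.
move=> ij; have E := hecke_qnorm ij; have E0 := hecke_exp_gt0 ij.
by rewrite ideal_norm_principal E; lia.
Qed.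

(** Modulo 16 the norm depends on r = x mod 8 and t = y mod 4 through r^2 - 2
t^2, and it is 9 only for (r, t) = (1, 2), (3, 0), (5, 0), (7, 2). *)
Lemma reduced_hecke x y : reduced x y -> (qnorm x y = 9 %[mod 16])%Z ->
  exists2 i, hecke_index i & x = hecke_x i /\ y = hecke_y i.
Proof.
move=> [x0 xy] /eqP; rewrite eqz_mod_dvd => /dvdzP[m mE].
have [k [r [xE r0 r8]]] : exists k r : int, [/\ x = 8 * k + r, 0 <= r & r < 8].
  exists (x %/ 8)%Z, (x %% 8)%Z.
  by split; [rewrite mulrC; exact: divz_eq | exact: modz_ge0 | exact: ltz_pmod].
have [l [t [yE t0 t4]]] : exists l t : int, [/\ y = 4 * l + t, 0 <= t & t < 4].
  exists (y %/ 4)%Z, (y %% 4)%Z.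
  by split; [rewrite mulrC; exact: divz_eq | exact: modz_ge0 | exact: ltz_pmod].
have {mE} [m' rt] : exists m' : int, r ^+ 2 - 2 * t ^+ 2 - 9 = 16 * m'.
  exists (m - (4 * k ^+ 2 + k * r - 2 * l ^+ 2 - l * t)).
  by rewrite mulrBr -[16 * m]mulrC -mE /qnorm xE yE; ring.
suff [n [w [e [wn xE' yE']]]] : exists n w e, [/\ 0 <= w < n,
    x = 4 * n + (if e then 1 else -1) & y = 2 * (n - 1 - 2 * w)].
  exists ((`|n|%N, `|w|%N), e); rewrite /hecke_index /hecke_x /hecke_y /=.
    by lia.
  by rewrite !gez0_abs; [| lia | lia].
have rE : r = 0 \/ r = 1 \/ r = 2 \/ r = 3 \/ r = 4 \/ r = 5 \/ r = 6 \/ r = 7 by lia.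
have tE : t = 0 \/ t = 1 \/ t = 2 \/ t = 3 by lia.
case: rE => [|[|[|[|[|[|[]]]]]]] rE; case: tE => [|[|[]]] tE;
  rewrite {}rE {}tE in xE yE rt; try (exfalso; lia).
(* the cases (1, 2), (3, 0), (5, 0), (7, 2) in this order *)
- by exists (2 * k), (k - l - 1), true; split; lia.
- by exists (2 * k + 1), (k - l), false; split; lia.
- by exists (2 * k + 1), (k - l), true; split; lia.
- by exists (2 * k + 2), (k - l), false; split; lia.
Qed.

(** Injectivity is the uniqueness of reduced generators; surjectivity is their
existence together with [reduced_hecke]. *)
Lemma hecke_ideal_bij : set_bij hecke_index
  [set a | [/\ is_ideal a, a != [set 0] & ideal_norm a = 9 %[mod 16]]] hecke_ideal.
Proof.
split.
- move=> i ij; have E0 := hecke_exp_gt0 ij; split; first exact: principal_ideal.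
    have [x0 _] := hecke_reduced ij.
    apply/eqP => /seteqP[+ _] => /(_ (qint (hecke_x i) (hecke_y i))).
    rewrite qint0 => /(_ _)/qint_inj[]; first by exists 1; rewrite ?mul1r.
    by move=> xE; rewrite xE in x0.
  by rewrite hecke_ideal_norm //; lia.
- move=> i j; rewrite !inE => ii ij E.
  have [] := reduced_unique (hecke_reduced ii) (hecke_reduced ij) E.
  case: i j {ii ij E} => [[s j] e] [[s' j'] e']; rewrite /hecke_x /hecke_y /=.
  by case: e e' => -[] xE yE; congr (_, _, _); lia.
- move=> I [idI I0 I9].
  have oddI : odd (ideal_norm I) by lia.
  have [x [y [rxy IE NE]]] := reduced_generator idI I0 oddI.
  have [|i ii [xE yE]] := reduced_hecke rxy; first by rewrite NE; lia.
  by exists i => //; rewrite IE xE yE.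
Qed.

End QuadraticIntegers.

Theorem theorem1p2 (K : fieldExtType rat) (sqrt2 : K)
    (hsqrt2 : sqrt2 ^+ 2 = 2) (hK : <<1%VS; sqrt2>>%VS = {:K}%VS) :
  let ideals9 : set (set (OK K)) :=
    [set a | [/\ is_ideal a, a != [set 0] & ideal_norm a = 9 %[mod 16]]] in
  [/\ fps_summable [set n | (1 <= n)%N] (f2_term ('q ^+ 16)),
      fps_summable ideals9 (fun a => 'q ^+ ideal_norm a) &
      (FracField.tofrac 'q) ^- 7 * FracField.tofrac (f2 ('q ^+ 16)) =
      FracField.tofrac (fps_sum ideals9 (fun a => 'q ^+ ideal_norm a))].
Proof.
move=> ideals9; have bij9 := hecke_ideal_bij hsqrt2 hK.
have norm9 i : hecke_index i ->
    ideal_norm (hecke_ideal hsqrt2 i) = (16 * hecke_exp i - 7)%N.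
  exact: hecke_ideal_norm.
split; first exact: f2_summable.
  move=> n; apply: sub_finite_set (finite_image (hecke_ideal hsqrt2) (hecke_finite n)).
  move=> a [a9]; rewrite /= fps_coefXn pnatr_eq0 eqb0 negbK => /eqP nE.
  have [_ _ /(_ _ a9)[i ii iE]] := bij9; exists i => //; split=> //.
  by move: nE; rewrite -iE norm9 //; have := hecke_exp_gt0 ii; lia.
suff -> : f2 ('q ^+ 16) = 'q ^+ 7 * fps_sum ideals9 (fun a => 'q ^+ ideal_norm a).
  rewrite rmorphM rmorphXn mulKf // expf_neq0 //.
  rewrite tofrac_eq0; apply/eqP => /fpsP/(_ 1%N)/eqP.
  by rewrite /= oner_eq0.
(* the coefficient k of f_2(q^16) counts the triples with 16 E = k, the
   coefficient k - 7 of the ideal series those with 16 E - 7 = k - 7 *)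
rewrite f2_heckeE; apply/fpsP => k; rewrite fps_coefXnM.
have reidx m : fps_coef (fps_sum ideals9 (fun a => 'q ^+ ideal_norm a)) m =
    \sum_(i \in hecke_index) ((m == 16 * hecke_exp i - 7)%N%:R : rat).
  rewrite /= (reindex_fsbig (hecke_ideal hsqrt2) hecke_index) //.
  by apply: eq_fsbigr => i; rewrite inE => ii; rewrite fps_coefXn norm9.
rewrite reidx; transitivity (\sum_(i \in hecke_index) ((k == 16 * hecke_exp i)%N%:R : rat)).
  transitivity (\sum_(i \in hecke_index) fps_coef ('q ^+ 16 ^+ hecke_exp i) k) => //.
  by apply: eq_fsbigr => i _; rewrite coefQ.
case: ltnP => k7.
  rewrite fsbig1 // => i ii; have := hecke_exp_gt0 ii => E0.
  by rewrite (_ : (_ == _) = false) //; lia.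
apply: eq_fsbigr => i; rewrite inE => ii; have := hecke_exp_gt0 ii => E0.
by congr (nat_of_bool _)%:R; lia.
Qed.
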